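(* Consider the single stage pricing game with multiplicative loyalty described in the context, with parameters $c_A\ge c_B\ge 0$, $l_\alpha,l_\beta>0$, $\theta\in(0,1)$, and $F$ the distribution function of the uniform distribution on $[0,1]$. Suppose (Region IV) $$2l_\alpha\le c_A-c_B\le l_\beta .$$ Then the game has a unique pure Nash equilibrium, and its prices are $$p_A^\alpha=c_A,\quad p_A^\beta=\tfrac13(2c_A+c_B+l_\beta),\quad p_B^\beta=\tfrac13(2c_B+c_A+2l_\beta),\quad p_B^\alpha=c_A-l_\alpha .$$
   Context: Two firms $A$ and $B$ sell the same product, with unit product costs $c_A$ and $c_B$, where $c_A\ge c_B\ge 0$. Customers are partitioned into a set $\alpha$ (ex ante loyal to $A$; a fraction $\theta$ of the market) and a set $\beta$ (ex ante loyal to $B$; a fraction $1-\theta$). Both firms can tell the two sets apart. Each customer buys exactly one unit, from $A$ or from $B$. Firms move simultaneously: $A$ chooses $(p_A^\alpha,p_A^\beta)$ with $p_A^\alpha,p_A^\beta\ge c_A$, and $B$ chooses $(p_B^\beta,p_B^\alpha)$ with $p_B^\beta,p_B^\alpha\ge c_B$; the superscript is the set of customers to which the price is offered. Multiplicative loyalty: a customer in $\alpha$ has loyalty level $l_\alpha\xi$ and buys from $A$ iff $l_\alpha\xi\ge p_A^\alpha-p_B^\alpha$; a customer in $\beta$ has loyalty level $l_\beta\xi$ and buys from $B$ iff $l_\beta\xi\ge p_B^\beta-p_A^\beta$; here $\xi$ is random with distribution function $F$. Put $\xi^\alpha=(p_A^\alpha-p_B^\alpha)/l_\alpha$ and $\xi^\beta=(p_B^\beta-p_A^\beta)/l_\beta$.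 For the uniform distribution, $F(x)=0$ for $x\le 0$, $F(x)=x$ for $0\le x\le1$, $F(x)=1$ for $x\ge1$. Profits: firm $A$ gets $(p_A^\alpha-c_A)\,\theta\,(1-F(\xi^\alpha))+(p_A^\beta-c_A)(1-\theta)F(\xi^\beta)$; firm $B$ gets $(p_B^\beta-c_B)(1-\theta)(1-F(\xi^\beta))+(p_B^\alpha-c_B)\,\theta\,F(\xi^\alpha)$. A pure Nash equilibrium is a price profile $(p_A^\alpha,p_A^\beta,p_B^\beta,p_B^\alpha)$ from which neither firm can strictly increase its profit by unilaterally changing its own (feasible) prices. *)

(* Defs.v *)
From Stdlib Require Import Reals.
Open Scope R_scope.

(** Single-stage pricing game between firms A and B with multiplicative
    loyalty, over the Stdlib real numbers. *)

(** [theta] is the fraction of the customers that are ex ante loyal to A (the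
    set alpha); the remaining fraction [1 - theta] (the set beta) is ex ante
    loyal to B.  [F] is the distribution function of the loyalty variable xi.
    Restrictions on the parameters are left to the theorems. *)
Record game := Game {
  c_A : R;
  c_B : R;
  l_alpha : R;
  l_beta : R;
  theta : R;
  F : R -> R }.

Record strategy_A := Strategy_A { p_A_alpha : R; p_A_beta : R }.
Record strategy_B := Strategy_B { p_B_beta : R; p_B_alpha : R }.

Definition feasible_A (G : game) (a : strategy_A) : Prop :=
  c_A G <= p_A_alpha a /\ c_A G <= p_A_beta a.

Definition feasible_B (G : game) (b : strategy_B) : Prop :=
  c_B G <= p_B_beta b /\ c_B G <= p_B_alpha b.

(** A customer of alpha buys from A iff [l_alpha * xi >= p_A_alpha - p_B_alpha],
    that is iff xi is at least [xi_alpha]; symmetrically for beta. *)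
Definition xi_alpha (G : game) (a : strategy_A) (b : strategy_B) : R :=
  (p_A_alpha a - p_B_alpha b) / l_alpha G.

Definition xi_beta (G : game) (a : strategy_A) (b : strategy_B) : R :=
  (p_B_beta b - p_A_beta a) / l_beta G.

Definition profit_A (G : game) (a : strategy_A) (b : strategy_B) : R :=
  (p_A_alpha a - c_A G) * theta G * (1 - F G (xi_alpha G a b))
  + (p_A_beta a - c_A G) * (1 - theta G) * F G (xi_beta G a b).

Definition profit_B (G : game) (a : strategy_A) (b : strategy_B) : R :=
  (p_B_beta b - c_B G) * (1 - theta G) * (1 - F G (xi_beta G a b))
  + (p_B_alpha b - c_B G) * theta G * F G (xi_alpha G a b).

Definition pure_nash (G : game) (s : strategy_A * strategy_B) : Prop :=
  let (a, b) := s in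
  feasible_A G a /\ feasible_B G b /\
  (forall a' : strategy_A, feasible_A G a' -> profit_A G a' b <= profit_A G a b) /\
  (forall b' : strategy_B, feasible_B G b' -> profit_B G a b' <= profit_B G a b).

(** Distribution function of the uniform distribution on [0,1]. *)
Definition uniform_cdf (x : R) : R :=
  if Rle_dec x 0 then 0 else if Rle_dec x 1 then x else 1.

(* Main.v *)
(** The profits are additive over the two customer sets, so a Nash equilibrium
    is a pair of independent equilibria, one per set, each between the firm the
    customers are loyal to (price [u], cost [cu]) and its rival (price [v], cost
    [cv]).  Measured in units of the loyalty level [l], such a market depends
    only on [t = (u - v) / l] and the margins [a = (u - cu) / l] and
    [b = (v - cv) / l].  Deviations force either the first-order conditions
    [a = 1 - t], [b = t] with [0 <= t < 1], or the limit-pricing corner [t = 1],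
    [a = 0], [b >= 1]; since [t - a + b = (cu - cv) / l], the costs decide which
    one occurs.  Region IV puts alpha in the corner and beta in the first case. *)

Require Import Defs.
From Stdlib Require Import Reals Lra.
Open Scope R_scope.

Lemma uniform_cdf_nonpos (x : R) : x <= 0 -> uniform_cdf x = 0.
Proof.
  intros Hx. unfold uniform_cdf. destruct (Rle_dec x 0); lra.
Qed.

Lemma uniform_cdf_mid (x : R) : 0 <= x <= 1 -> uniform_cdf x = x.
Proof.
  intros Hx. unfold uniform_cdf.
  destruct (Rle_dec x 0); destruct (Rle_dec x 1); lra.
Qed.

Lemma uniform_cdf_ge1 (x : R) : 1 <= x -> uniform_cdf x = 1.
Proof.
  intros Hx. unfold uniform_cdf.
  destruct (Rle_dec x 0); destruct (Rle_dec x 1); lra.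
Qed.

Lemma uniform_cdf_cases (x : R) :
  (x <= 0 /\ uniform_cdf x = 0) \/ (0 <= x <= 1 /\ uniform_cdf x = x) \/
  (1 <= x /\ uniform_cdf x = 1).
Proof.
  unfold uniform_cdf. destruct (Rle_dec x 0); destruct (Rle_dec x 1); lra.
Qed.

Definition loyal_payoff (l c u v : R) : R :=
  (u - c) * (1 - uniform_cdf ((u - v) / l)).

Definition rival_payoff (l c u v : R) : R :=
  (v - c) * uniform_cdf ((u - v) / l).

Definition market_nash (l cu cv u v : R) : Prop :=
  cu <= u /\ cv <= v /\
  (forall u', cu <= u' -> loyal_payoff l cu u' v <= loyal_payoff l cu u v) /\
  (forall v', cv <= v' -> rival_payoff l cv u v' <= rival_payoff l cv u v).

(** Each profit is a sum, weighted by [th] and [1 - th], of payoffs in separate price variables: a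
    deviation in one price isolates one market, and its positive weight cancels. *)
Lemma pure_nash_iff_markets (cA cB la lb th xa xb yb ya : R) :
  0 < th -> th < 1 ->
  pure_nash (Game cA cB la lb th uniform_cdf)
    (Strategy_A xa xb, Strategy_B yb ya) <->
  market_nash la cA cB xa ya /\ market_nash lb cB cA yb xb.
Proof.
  intros H0 H1.
  assert (EA : forall x x', profit_A (Game cA cB la lb th uniform_cdf)
      (Strategy_A x x') (Strategy_B yb ya) =
      th * loyal_payoff la cA x ya + (1 - th) * rival_payoff lb cA yb x').
  { intros; unfold profit_A, xi_alpha, xi_beta, loyal_payoff, rival_payoff; simpl.
    ring. }
  assert (EB : forall y y', profit_B (Game cA cB la lb th uniform_cdf)
      (Strategy_A xa xb) (Strategy_B y y') =
      (1 - th) * loyal_payoff lb cB y xb + th * rival_payoff la cB xa y').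
  { intros; unfold profit_B, xi_alpha, xi_beta, loyal_payoff, rival_payoff; simpl.
    ring. }
  unfold pure_nash, feasible_A, feasible_B, market_nash; simpl; split.
  - intros [[F1 F2] [[F3 F4] [HA HB]]].
    repeat split; trivial.
    + intros u' Hu. specialize (HA (Strategy_A u' xb) (conj Hu F2)).
      rewrite !EA in HA. apply (Rmult_le_reg_l th); lra.
    + intros v' Hv. specialize (HB (Strategy_B yb v') (conj F3 Hv)).
      rewrite !EB in HB. apply (Rmult_le_reg_l th); lra.
    + intros u' Hu. specialize (HB (Strategy_B u' ya) (conj Hu F4)).
      rewrite !EB in HB. apply (Rmult_le_reg_l (1 - th)); lra.
    + intros v' Hv. specialize (HA (Strategy_A xa v') (conj F1 Hv)).
      rewrite !EA in HA. apply (Rmult_le_reg_l (1 - th)); lra.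
  - intros [[F1 [F4 [HA1 HB1]]] [F3 [F2 [HB2 HA2]]]].
    repeat split; trivial.
    + intros [x x'] [Hx Hx']; simpl in *. rewrite !EA.
      apply Rplus_le_compat; apply Rmult_le_compat_l; auto; lra.
    + intros [y y'] [Hy Hy']; simpl in *. rewrite !EB.
      apply Rplus_le_compat; apply Rmult_le_compat_l; auto; lra.
Qed.

(** [s] is the scaled price difference after a deviation, bounded so that no price falls below cost.
    If [t < 0] the loyal firm, and if [t > 1] the rival, can raise its price without losing a
    customer. *)
Lemma unit_market_cases (t a b : R) :
  0 <= a -> 0 <= b -> -1 <= t - a + b ->
  (forall s, t - a <= s ->
     (a + s - t) * (1 - uniform_cdf s) <= a * (1 - uniform_cdf t)) ->
  (forall s, s <= t + b ->
     (b + t - s) * uniform_cdf s <= b * uniform_cdf t) ->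
  (0 <= t < 1 /\ a = 1 - t /\ b = t) \/ (t = 1 /\ a = 0 /\ 1 <= b).
Proof.
  intros Ha Hb Hk HL HR.
  destruct (Rlt_le_dec t 0) as [Ht|Ht].
  { exfalso.
    specialize (HL 0 ltac:(lra)).
    rewrite (uniform_cdf_nonpos 0), (uniform_cdf_nonpos t) in HL; lra. }
  destruct (Rlt_le_dec 1 t) as [Ht1|Ht1].
  { exfalso. specialize (HR 1 ltac:(lra)).
    rewrite (uniform_cdf_ge1 1), (uniform_cdf_ge1 t) in HR; lra. }
  rewrite (uniform_cdf_mid t) in HL, HR by lra.
  assert (HaL : t < 1 -> 1 - t <= a).
  { intros Hlt. apply Rnot_lt_le; intros Hc.
    (* This point is the vertex of the parabola [(a + s - t) * (1 - s)]. *)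
    specialize (HL (t + (1 - t - a) / 2) ltac:(lra)).
    rewrite uniform_cdf_mid in HL by lra. nra. }
  assert (HaU : 0 < t -> a <= 1 - t).
  { intros Hpos. apply Rnot_lt_le; intros Hc.
    (* A step towards the same vertex, cut off at [t] so that [t - e] stays where the cdf is
       linear. *)
    pose proof (Rmin_l t ((a - (1 - t)) / 2)) as M1.
    pose proof (Rmin_r t ((a - (1 - t)) / 2)) as M2.
    assert (M3 : 0 < Rmin t ((a - (1 - t)) / 2)) by (apply Rmin_glb_lt; lra).
    set (e := Rmin t ((a - (1 - t)) / 2)) in *.
    specialize (HL (t - e) ltac:(lra)).
    rewrite uniform_cdf_mid in HL by lra. nra. }
  assert (HbU : t < 1 -> b <= t).
  { intros Hlt. apply Rnot_lt_le; intros Hc.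
    pose proof (Rmin_l (1 - t) ((b - t) / 2)) as M1.
    pose proof (Rmin_r (1 - t) ((b - t) / 2)) as M2.
    assert (M3 : 0 < Rmin (1 - t) ((b - t) / 2)) by (apply Rmin_glb_lt; lra).
    set (e := Rmin (1 - t) ((b - t) / 2)) in *.
    specialize (HR (t + e) ltac:(lra)).
    rewrite uniform_cdf_mid in HR by lra. nra. }
  assert (HbL : 0 < t -> t <= b).
  { intros Hpos. apply Rnot_lt_le; intros Hc.
    specialize (HR (t - (t - b) / 2) ltac:(lra)).
    rewrite uniform_cdf_mid in HR by lra. nra. }
  (* At [t = 0] the bound [a <= 1] comes from [-1 <= t - a + b] and [b = 0]. *)
  lra.
Qed.

(** The scaled cost gap [t - a + b] equals [3 * t - 1 < 2] in the first case and [1 + b >= 2] in the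
    corner, so it selects the case and then fixes the prices. *)
Lemma market_nash_cases (l cu cv u v : R) :
  0 < l -> - l <= cu - cv -> market_nash l cu cv u v ->
  (cu - cv < 2 * l /\ u = (2 * cu + cv + 2 * l) / 3 /\
     v = (2 * cv + cu + l) / 3) \/
  (2 * l <= cu - cv /\ u = cu /\ v = cu - l).
Proof.
  intros Hl Hd [Hu [Hv [HL HR]]].
  set (t := (u - v) / l). set (a := (u - cu) / l). set (b := (v - cv) / l).
  assert (Et : u - v = l * t) by (unfold t; field; lra).
  assert (Ea : u - cu = l * a) by (unfold a; field; lra).
  assert (Eb : v - cv = l * b) by (unfold b; field; lra).
  assert (Hcase : (0 <= t < 1 /\ a = 1 - t /\ b = t) \/ (t = 1 /\ a = 0 /\ 1 <= b)).
  { apply unit_market_cases.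
    - apply (Rmult_le_reg_l l); lra.
    - apply (Rmult_le_reg_l l); lra.
    - apply (Rmult_le_reg_l l); lra.
    - intros s Hs. apply (Rmult_le_compat_l l) in Hs; [|lra].
      specialize (HL (v + l * s) ltac:(lra)). unfold loyal_payoff in HL.
      replace ((v + l * s - v) / l) with s in HL by (field; lra).
      replace (v + l * s - cu) with (l * (a + s - t)) in HL by lra.
      fold t in HL. rewrite Ea in HL.
      apply (Rmult_le_reg_l l); lra.
    - intros s Hs. apply (Rmult_le_compat_l l) in Hs; [|lra].
      specialize (HR (u - l * s) ltac:(lra)). unfold rival_payoff in HR.
      replace ((u - (u - l * s)) / l) with s in HR by (field; lra).
      replace (u - l * s - cv) with (l * (b + t - s)) in HR by lra.
      fold t in HR. rewrite Eb in HR.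
      apply (Rmult_le_reg_l l); lra. }
  clearbody t a b.
  destruct Hcase as [[Ht [-> ->]] | [-> [-> Hb]]].
  - left. assert (l * t < l * 1) by (apply Rmult_lt_compat_l; lra). lra.
  - right. assert (l * 1 <= l * b) by (apply Rmult_le_compat_l; lra). lra.
Qed.

Lemma market_nash_interior (l cu cv : R) :
  0 < l -> - l <= cu - cv <= 2 * l ->
  market_nash l cu cv ((2 * cu + cv + 2 * l) / 3) ((2 * cv + cu + l) / 3).
Proof.
  intros Hl Hd.
  set (u := (2 * cu + cv + 2 * l) / 3). set (v := (2 * cv + cu + l) / 3).
  set (t := (u - v) / l).
  assert (Et : u - v = l * t) by (unfold t; field; lra).
  assert (Eu : u - cu = l * (1 - t)) by (unfold u, v in *; lra).
  assert (Ev : v - cv = l * t) by (unfold u, v in *; lra).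
  assert (Ht : 0 <= t <= 1)
    by (split; apply (Rmult_le_reg_l l); unfold u, v in *; lra).
  unfold market_nash, loyal_payoff, rival_payoff. fold t.
  rewrite (uniform_cdf_mid t Ht), Eu, Ev.
  split; [unfold u; lra|]. split; [unfold v; lra|]. split.
  - intros u' Hu'. set (s := (u' - v) / l).
    assert (Es : u' - v = l * s) by (unfold s; field; lra).
    replace (u' - cu) with (l * (s + 1 - 2 * t)) by lra.
    rewrite !Rmult_assoc. apply Rmult_le_compat_l; [lra|].
    (* On the linear piece the deviation loses exactly [(s - t) ^ 2]; the other two squares settle
       [s <= 0] and [s >= 1]. *)
    pose proof (pow2_ge_0 t); pose proof (pow2_ge_0 (1 - t)).
    pose proof (pow2_ge_0 (s - t)).
    destruct (uniform_cdf_cases s) as [[Hs ->]|[[Hs ->]|[Hs ->]]]; lra.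
  - intros v' Hv'. set (s := (u - v') / l).
    assert (Es : u - v' = l * s) by (unfold s; field; lra).
    replace (v' - cv) with (l * (2 * t - s)) by lra.
    rewrite !Rmult_assoc. apply Rmult_le_compat_l; [lra|].
    pose proof (pow2_ge_0 t); pose proof (pow2_ge_0 (1 - t)).
    pose proof (pow2_ge_0 (s - t)).
    destruct (uniform_cdf_cases s) as [[Hs ->]|[[Hs ->]|[Hs ->]]]; lra.
Qed.

Lemma market_nash_corner (l cu cv : R) :
  0 < l -> 2 * l <= cu - cv -> market_nash l cu cv cu (cu - l).
Proof.
  intros Hl Hd. unfold market_nash, loyal_payoff, rival_payoff.
  replace ((cu - (cu - l)) / l) with 1 by (field; lra).
  rewrite (uniform_cdf_ge1 1) by lra.
  split; [lra|]. split; [lra|]. split.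
  - intros u' Hu'. rewrite uniform_cdf_ge1; [lra|].
    apply (Rmult_le_reg_l l); [lra|].
    replace (l * ((u' - (cu - l)) / l)) with (u' - cu + l) by (field; lra). lra.
  - intros v' Hv'. set (s := (cu - v') / l).
    assert (Es : v' = cu - l * s) by (unfold s; field; lra).
    destruct (uniform_cdf_cases s) as [[Hs ->]|[[Hs ->]|[Hs ->]]]; [lra| |nra].
    assert (Hls : l * s <= l * 1) by (apply Rmult_le_compat_l; lra).
    (* This product is the rival's loss from moving the scaled difference from 1 to [s]. *)
    assert (Hp : 0 <= (1 - s) * (cu - cv - l - l * s)) by (apply Rmult_le_pos; lra).
    rewrite Es. lra.
Qed.

Theorem proposition13 (cA cB la lb th : R)
  (hcB : 0 <= cB) (hcA : cB <= cA)
  (hla : 0 < la) (hlb : 0 < lb)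
  (hth0 : 0 < th) (hth1 : th < 1)
  (hIV_alpha : 2 * la <= cA - cB) (hIV_beta : cA - cB <= lb) :
  unique (pure_nash (Game cA cB la lb th uniform_cdf))
    (Strategy_A (* p_A_alpha *) cA
                (* p_A_beta *) ((2 * cA + cB + lb) / 3),
     Strategy_B (* p_B_beta *) ((2 * cB + cA + 2 * lb) / 3)
                (* p_B_alpha *) (cA - la)).
Proof.
  split.
  - apply pure_nash_iff_markets; trivial. split.
    + apply market_nash_corner; lra.
    + apply market_nash_interior; lra.
  - intros [[xa xb] [yb ya]] Hnash.
    apply pure_nash_iff_markets in Hnash; trivial.
    destruct Hnash as [Halpha Hbeta].
    apply market_nash_cases in Halpha; [|lra|lra].
    (* In beta the loyal firm is B, so the gap is [cB - cA]: at least [- lb] by [hIV_beta], and at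
       most 0, which excludes the corner. *)
    apply market_nash_cases in Hbeta; [|lra|lra].
    f_equal; f_equal; lra.
Qed.
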